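(* Let $\Delta\in\mathbb{N}$ with $\Delta\ge 3$ and let $\lambda_\Delta:=\frac{(\Delta-1)^{\Delta-1}}{(\Delta-2)^{\Delta}}$. Then for any $\varepsilon>0$ there exists $\delta>0$ such that for any graph $G=(V,E)$ of maximum degree at most $\Delta$ and any $\lambda=(\lambda_v)_{v\in V}\in\mathbb{C}^V$ satisfying $\lambda_v\in\mathcal{N}([0,(1-\varepsilon)\lambda_\Delta),\delta)$ for each $v\in V$, we have $Z_G(\lambda)\neq 0$.
   Context: Graphs are finite and simple. For a graph $G=(V,E)$ and $\lambda=(\lambda_v)_{v\in V}\in\mathbb{C}^V$, the multivariate independence polynomial is $Z_G(\lambda)=\sum_{I}\prod_{v\in I}\lambda_v$, where the sum is over all independent sets $I\subseteq V$ (sets spanning no edge of $G$, including the empty set). For $A\subset\mathbb{C}$ and $\delta>0$, $\mathcal{N}(A,\delta):=\{z\in\mathbb{C}\mid |z-a|<\delta\text{ for some }a\in A\}$. *)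

(* Defs.v *)
From mathcomp Require Import all_boot all_order all_algebra.
From mathcomp Require Import complex.
From mathcomp Require Import all_classical reals.

Set Implicit Arguments.
Unset Strict Implicit.
Unset Printing Implicit Defensive.

Import Order.TTheory GRing.Theory Num.Theory.

Local Open Scope ring_scope.
Local Open Scope complex_scope.
Local Open Scope classical_set_scope.

Record sgraph := SGraph {
  vertex :> finType;
  edge : rel vertex;
  edge_sym : symmetric edge;
  edge_irrefl : irreflexive edge }.

Definition degree (G : sgraph) (v : G) : nat := #|[set w | edge v w]%SET|.

Definition max_degree (G : sgraph) : nat := (\max_(v : G) degree v)%N.

Definition independent (G : sgraph) (I : {set G}) : bool :=
  [forall u in I, forall v in I, ~~ edge u v].

Definition indep_poly (R : rcfType) (G : sgraph) (lambda : G -> R[i]) : R[i] :=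
  \sum_(I : {set G} | independent I) \prod_(v in I) lambda v.

(* The norm of [R[i]] takes its values in [R[i]], hence the embedding of
   [delta]. *)
Definition nbhd (R : rcfType) (A : set R[i]) (delta : R) : set R[i] :=
  [set z | exists2 a, A a & `|z - a| < delta%:C].

(* Subtraction is on [nat]; it is only meaningful for [2 < Delta]. *)
Definition lambda_crit (R : rcfType) (Delta : nat) : R :=
  (Delta - 1)%:R ^+ (Delta - 1) / (Delta - 2)%:R ^+ Delta.

(* The half-open real segment [0, c), seen in the complex plane; it is empty
   when [c <= 0]. *)
Definition real_segment (R : rcfType) (c : R) : set R[i] :=
  [set x%:C | x in `[0, c[].

(* Main.v *)
Require Import Defs.
From mathcomp Require Import all_boot all_order all_algebra.
From mathcomp Require Import complex.
From mathcomp Require Import all_classical reals.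
From mathcomp Require Import ring lra.

Set Implicit Arguments.
Unset Strict Implicit.
Unset Printing Implicit Defensive.

Import Order.TTheory GRing.Theory Num.Theory.

Local Open Scope ring_scope.
Local Open Scope complex_scope.
Local Open Scope classical_set_scope.

(** Write [d = Delta - 1] and [Z(S)] for the sum over the independent subsets of
    [S].  For [v] outside [S] one has [Z(S + v) = (1 + z) Z(S)], where the ratio
    [z = lambda_v Z(S - N(v)) / Z(S)] satisfies
    [z = lambda_v / \prod_i (1 + z_i)], the [z_i] being the ratios obtained when
    the neighbours of [v] in [S] are put back one by one into [S - N(v)].  Each
    of those vertices has the neighbour [v] outside [S], hence at most [d]
    neighbours in [S].  So [Z] has no zero as soon as some region [D] of the
    plane is mapped into itself by this recursion with [d] arguments, and the
    recursion with [d + 1] arguments, which serves when nothing is known about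
    the degree of [v] in [S], never takes the value [-1]
    ([indep_poly_neq0_of_region]).

    Such a region is found near the segment [[0, L]], where
    [L = (1 - eps) lambda_Delta].  On the positive reals the recursion is a
    contraction for the metric [dr / sqrt (r (1 + r))]: an infinitesimal
    displacement [e_i] of each [r_i] displaces [x = lambda / \prod_i (1 + r_i)]
    by [- x \sum_i e_i / (1 + r_i)], and
    [x \sum_i sqrt (r_i (1 + r_i)) / (1 + r_i) <= q sqrt (x (1 + x))] with
    [q < 1], by Cauchy-Schwarz, the arithmetic-geometric mean inequality and
    the extremal property of the critical activity
    ([sqrt_potential_contracts]).  Adding a small constant to the weight keeps
    the contraction and makes the weight, called [psi], bounded away from 0
    ([potential_contracts]).

    The region is the union of the discs of centre [r] in [[0, L]] and radius
    [eta psi(r)].  The recursion is compared with its linearization by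
    [|1 / \prod_i (1 + u_i) - 1| <= s / (1 - s)] for [s = \sum_i |u_i|]
    ([prod_near1]); for small [eta], and [delta] much smaller,
    the factor [1 / (1 - s)] and the distance from [lambda_v] to the segment are
    absorbed by the contraction ([invariant_region]). *)

(** * The real recursion below the critical activity *)

Lemma AGM_ord (R : realFieldType) (n : nat) (a : 'I_n -> R) :
  (forall i, 0 <= a i) -> \prod_i a i <= ((\sum_i a i) / n%:R) ^+ n.
Proof.
move=> a0; have [+ _] := @leif_AGM R 'I_n predT a (fun i _ => a0 i).
by rewrite cardT size_enum_ord.
Qed.

Lemma sqr_sum_le (R : realFieldType) (n : nat) (a : 'I_n -> R) :
  (\sum_i a i) ^+ 2 <= n%:R * \sum_i a i ^+ 2.
Proof.
elim: n a => [|n IHn] a; first by rewrite !big_ord0 expr0n mulr0.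
rewrite !big_ord_recr /=; set s := \sum_i _; set q := \sum_i _; set b := a _.
have IH : s ^+ 2 <= n%:R * q by exact: IHn.
have cross : 2 * (b * s) <= n%:R * b ^+ 2 + q.
  have : 0 <= \sum_(i < n) (b - a (widen_ord (leqnSn n) i)) ^+ 2.
    by apply: sumr_ge0 => i _; exact: sqr_ge0.
  suff -> : \sum_(i < n) (b - a (widen_ord (leqnSn n) i)) ^+ 2
            = n%:R * b ^+ 2 - 2 * (b * s) + q by lra.
  have -> : n%:R * b ^+ 2 = \sum_(i < n) b ^+ 2.
    by rewrite sumr_const card_ord mulr_natl.
  rewrite /s !mulr_sumr -sumrN -!big_split /=.
  by apply: eq_bigr => i _; ring.
by rewrite -natr1; nra.
Qed.

Lemma lambda_crit_gt0 (R : rcfType) (Delta : nat) :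
  (2 < Delta)%N -> 0 < lambda_crit R Delta.
Proof.
move=> D2; have D1 : (1 < Delta)%N by apply: ltn_trans D2.
by apply: divr_gt0; apply: exprn_gt0; rewrite ltr0n subn_gt0.
Qed.

(** The critical activity is the reciprocal of the maximum over [m] of
    [m ^ d (d^2 - 1 - d^2 m)], attained at [m = (d - 1) / d]: apply the
    arithmetic-geometric mean inequality to [d] copies of [d m] and to the
    last factor, whose sum does not depend on [m]. *)
Lemma lambda_crit_bound (R : rcfType) (d : nat) (m : R) : (1 < d)%N -> 0 <= m ->
  0 <= d%:R ^+ 2 - 1 - d%:R ^+ 2 * m ->
  lambda_crit R d.+1 * (m ^+ d * (d%:R ^+ 2 - 1 - d%:R ^+ 2 * m)) <= 1.
Proof.
move=> d1 m0 b0; set b := _ - _.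
have d0 : 0 < d%:R :> R by rewrite ltr0n; apply: ltn_trans d1.
have e0 : 0 < (d - 1)%:R :> R by rewrite ltr0n subn_gt0.
have eE : (d - 1)%:R = d%:R - 1 :> R by rewrite natrB // ltnW.
have := @AGM_ord R d.+1
  (fun i => if i == ord_max then b else d%:R * m).
have lt_max (i : 'I_d) : (widen_ord (leqnSn d) i == ord_max) = false.
  by apply/negbTE; rewrite -val_eqE /= neq_ltn ltn_ord.
rewrite !big_ord_recr /= eqxx.
under eq_bigr do rewrite lt_max; under [\sum_i _]eq_bigr do rewrite lt_max.
rewrite prodr_const sumr_const card_ord -[(_ * m) *+ d]mulr_natl => AGM.
have {AGM} : (d%:R * m) ^+ d * b <= (d - 1)%:R ^+ d.+1.
  have -> : (d - 1)%:R = (d%:R * (d%:R * m) + b) / d.+1%:R :> R.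
    rewrite /b eE -natr1; field; rewrite natr1; exact: lt0r_neq0.
  by apply: AGM => i; case: ifP => // _; rewrite mulr_ge0 // ltW.
rewrite /lambda_crit subSS subn0 -[(d.+1 - 2)%N]/(d.+1 - 1.+1)%N subSS exprMn => H.
by rewrite mulrAC ler_pdivrMr ?exprn_gt0 // mul1r mulrA.
Qed.

(** With [s_i = 1 / (1 + r_i)] and [m] their mean, Cauchy-Schwarz bounds the
    square of the sum by [d^2 (1 - m)], and the arithmetic-geometric mean
    inequality bounds [x] by [X = lam m^d].  As [x / (1 + x)] increases with
    [x], the claim follows from the same inequality at [X], which is
    [lambda_crit_bound]. *)
Lemma sqrt_potential_contracts (R : rcfType) (d : nat) (eps lam : R)
    (r : 'I_d -> R) (x := lam / \prod_i (1 + r i)) :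
  (1 < d)%N -> 0 < eps < 1 -> 0 <= lam <= (1 - eps) * lambda_crit R d.+1 ->
  (forall i, 0 <= r i) ->
  x * \sum_i (Num.sqrt (r i * (1 + r i)) / (1 + r i))
  <= Num.sqrt (1 - eps / (1 + lambda_crit R d.+1)) * Num.sqrt (x * (1 + x)).
Proof.
move=> d1 /andP[e0 e1] /andP[l0 l1] r0.
have lc0 : 0 < lambda_crit R d.+1 by exact: lambda_crit_gt0.
set lc := lambda_crit R d.+1 in l1 lc0 *; set c := eps / (1 + lc).
have dp : 0 < d%:R :> R by rewrite ltr0n; apply: ltn_trans d1.
have c0 : 0 < c by apply: divr_gt0 => //; lra.
have cE : c * (1 + lc) = eps by rewrite divfK //; lra.
have c1 : c < 1 by rewrite ltr_pdivrMr; lra.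
have rp i : 0 < 1 + r i by have := r0 i; lra.
pose s i := (1 + r i)^-1.
have s0 i : 0 < s i by rewrite invr_gt0.
have s1 i : s i <= 1 by rewrite invf_le1 //; have := r0 i; lra.
pose m := (\sum_i s i) / d%:R.
have sumE : \sum_i s i = d%:R * m by rewrite /m mulrCA mulfV ?mulr1 ?gt_eqF.
have m0 : 0 <= m by rewrite divr_ge0 ?sumr_ge0 ?ltW // => i _; exact: ltW.
have m1 : m <= 1.
  rewrite ler_pdivrMr // mul1r -[X in _ <= X%:R]card_ord -sumr_const.
  by apply: ler_sum => i _; exact: s1.
have md1 : m ^+ d <= 1 by exact: exprn_ile1.
have md0 : 0 <= m ^+ d by exact: exprn_ge0.
set T := \sum_i _.
have T2 : T ^+ 2 <= d%:R ^+ 2 * (1 - m).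
  apply: le_trans (sqr_sum_le _) _.
  rewrite expr2 -mulrA ler_pM2l // mulrBr mulr1 -sumE.
  rewrite -[X in _ <= X%:R - _]card_ord -sumr_const -sumrB.
  apply: ler_sum => i _.
  rewrite exprMn sqr_sqrtr ?mulr_ge0 ?(ltW (rp i)) //.
  have := rp i => /lt0r_neq0 rn; rewrite /s le_eqVlt; apply/orP; left.
  by apply/eqP; field.
have T0 : 0 <= T.
  by apply: sumr_ge0 => i _; rewrite divr_ge0 ?sqrtr_ge0 // ltW.
have xE : x = lam * \prod_i s i by rewrite /x prodfV.
have x0 : 0 <= x by rewrite xE mulr_ge0 ?prodr_ge0 // => i _; exact: ltW.
pose X := lam * m ^+ d.
have xX : x <= X.
  by rewrite xE ler_wpM2l //; apply: AGM_ord => i; exact: ltW.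
clearbody x.
have Xl : X <= lc.
  apply: (@le_trans _ _ lam); first by rewrite ler_piMr.
  by apply: le_trans l1 _; nra.
have step : X * (d%:R ^+ 2 * (1 - m)) <= 1 - eps + X.
  have [b0|b0] := leP 0 (d%:R ^+ 2 - 1 - d%:R ^+ 2 * m); last first.
    have : X * (d%:R ^+ 2 - 1 - d%:R ^+ 2 * m) <= 0.
      by rewrite mulr_ge0_le0 ?mulr_ge0 // ltW.
    by nra.
  have H := lambda_crit_bound d1 m0 b0; rewrite -/lc in H.
  have H2 : X * (d%:R ^+ 2 - 1 - d%:R ^+ 2 * m) <= 1 - eps.
    apply: (@le_trans _ _ ((1 - eps) * (lc * (m ^+ d * (d%:R ^+ 2 - 1 - d%:R ^+ 2 * m))))).
      by rewrite /X -mulrA [leRHS]mulrA ler_wpM2r // mulr_ge0.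
    by rewrite ler_piMr //; lra.
  by nra.
(* This is where the value c = eps / (1 + lc) comes from: since X <= lc,
   c (1 + X) <= eps. *)
have step2 : X * (d%:R ^+ 2 * (1 - m)) <= (1 - c) * (1 + X) by nra.
have B0 : 0 <= d%:R ^+ 2 * (1 - m) by rewrite mulr_ge0 ?sqr_ge0 //; lra.
set B := d%:R ^+ 2 * (1 - m) in T2 step2 B0.
have step3 : x * B <= (1 - c) * (1 + x).
  rewrite -(@ler_pM2r _ (1 + X)); last by lra.
  apply: (@le_trans _ _ ((1 + x) * (X * B))); last by nra.
  suff : 0 <= (X - x) * B by nra.
  by apply: mulr_ge0 => //; lra.
rewrite -sqrtrM; last lra.
rewrite -(@ler_pXn2r _ 2) ?nnegrE ?mulr_ge0 ?sqrtr_ge0 //.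
rewrite sqr_sqrtr; last by apply: mulr_ge0; [lra | apply: mulr_ge0; lra].
rewrite exprMn expr2 -mulrA [leRHS]mulrCA ler_wpM2l //.
by apply: le_trans step3; rewrite ler_wpM2l.
Qed.

(** The weight [sqrt (r (1 + r))] vanishes at 0, which would leave no room for
    an error there.  Adding the constant [c / d] costs at most [x c] on the
    left, which is at most [c sqrt (x (1 + x))] and so is paid for by half of
    the gap [1 - q = 2 c], where [q] is the factor of
    [sqrt_potential_contracts]. *)
Lemma potential_contracts (R : rcfType) (d : nat) (eps : R) :
  (1 < d)%N -> 0 < eps < 1 ->
  exists c : R, [/\ 0 < c <= 2^-1 &
  forall lam (r : 'I_d -> R) (x := lam / \prod_i (1 + r i)),
    0 <= lam <= (1 - eps) * lambda_crit R d.+1 -> (forall i, 0 <= r i) ->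
    x * \sum_i ((Num.sqrt (r i * (1 + r i)) + c / d%:R) / (1 + r i))
    <= (1 - c) * (Num.sqrt (x * (1 + x)) + c / d%:R)].
Proof.
move=> d1 /andP[e0 e1].
have dp : 0 < d%:R :> R by rewrite ltr0n; apply: ltn_trans d1.
have lc0 : 0 < lambda_crit R d.+1 by exact: lambda_crit_gt0.
pose q : R := Num.sqrt (1 - eps / (1 + lambda_crit R d.+1)).
have q0 : 0 <= q by exact: sqrtr_ge0.
have q1 : q < 1.
  rewrite -[ltRHS]sqrtr1 ltr_sqrt //.
  have : 0 < eps / (1 + lambda_crit R d.+1) by apply: divr_gt0 => //; lra.
  by lra.
exists ((1 - q) / 2); split; first by apply/andP; split; lra.
move=> lam r x /andP[l0 l1] r0; set c := (1 - q) / 2.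
have rp i : 1 <= 1 + r i by have := r0 i; lra.
have x0 : 0 <= x.
  by rewrite divr_ge0 ?prodr_ge0 // => i _; exact: le_trans (rp i).
have main : x * \sum_i (Num.sqrt (r i * (1 + r i)) / (1 + r i))
    <= q * Num.sqrt (x * (1 + x)).
  by apply: sqrt_potential_contracts => //; apply/andP.
have xphi : x <= Num.sqrt (x * (1 + x)).
  by rewrite -[leLHS]ger0_norm // -sqrtr_sqr ler_wsqrtr //; nra.
have kd : c / d%:R * d%:R = c by rewrite divfK ?gt_eqF.
have k0 : 0 < c / d%:R by apply: divr_gt0 => //; rewrite /c; lra.
under eq_bigr do rewrite mulrDl.
rewrite big_split /= mulrDr.
have rest : \sum_i (c / d%:R / (1 + r i)) <= c.
  rewrite -[leRHS]kd -[X in _ * X%:R]card_ord mulr_natr -sumr_const.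
  apply: ler_sum => i _; rewrite ler_pdivrMr; last exact: lt_le_trans (rp i).
  by rewrite ler_peMr // ltW.
have : x * \sum_i (c / d%:R / (1 + r i)) <= x * c by rewrite ler_wpM2l.
have c0 : 0 < c by rewrite /c; lra.
have : c * x <= c * Num.sqrt (x * (1 + x)) by rewrite ler_pM2l.
have : 0 < (1 - c) * (c / d%:R) by apply: mulr_gt0 => //; rewrite /c; lra.
move: main; have -> : q = 1 - 2 * c by rewrite /c; field.
by lra.
Qed.

(** * Products of complex numbers near 1 *)

Import ComplexField.Normc.

Lemma normr_normc (R : rcfType) (z : R[i]) : `|z| = (normc z)%:C.
Proof. by []. Qed.

Lemma normcD (R : rcfType) (y z : R[i]) : normc (y + z) <= normc y + normc z.
Proof. by rewrite -lecR rmorphD /= -!normr_normc ler_normD. Qed.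

Lemma normc_ge0 (R : rcfType) (z : R[i]) : 0 <= normc z.
Proof. by rewrite -lecR -normr_normc normr_ge0. Qed.

Lemma normc_real (R : rcfType) (x : R) : 0 <= x -> normc x%:C = x.
Proof. by move=> x0; rewrite /= expr0n addr0 sqrtr_sqr ger0_norm. Qed.

Lemma normc_opp (R : rcfType) (z : R[i]) : normc (- z) = normc z.
Proof. by apply/eqP; rewrite -(inj_eq (@complexI R)) -!normr_normc normrN. Qed.

(** Equivalent to [|1 / Q - 1| <= s / (1 - s)] with [s] the sum of the [a i],
    free of division; in this form the bound is stable under one more
    factor. *)
Lemma prod_near1 (R : rcfType) (n : nat) (u : 'I_n -> R[i]) (a : 'I_n -> R)
    (Q := \prod_i (1 + u i)) :
  (forall i, normc (u i) <= a i) -> \sum_i a i < 1 ->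
  1 - \sum_i a i <= normc Q /\
  normc (1 - Q) * (1 - \sum_i a i) <= (\sum_i a i) * normc Q.
Proof.
rewrite /Q; elim: n u a {Q} => [|n IHn] u a ua.
  by rewrite !big_ord0 subrr normc0 normc1 subr0 !mul0r; split.
rewrite !big_ord_recr /= => s1.
have a0 i : 0 <= a i by exact: le_trans (normc_ge0 _) (ua i).
set w := widen_ord _ in s1 *.
set s := \sum_(i < n) _ in s1 *; set t := a ord_max in s1 *.
have s0 : 0 <= s by apply: sumr_ge0.
have t0 : 0 <= t by exact: a0.
have ut : normc (u ord_max) <= t by exact: ua.
set v := u ord_max in ut *.
have := IHn (fun i => u (w i)) (fun i => a (w i)) (fun i => ua (w i)).
rewrite -/s; set Q := \prod_(i < n) _ => -[|Q0 Q1]; first lra.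
have v1 : 1 - t <= normc (1 + v).
  have : normc (1 : R[i]) <= normc (1 + v) + normc (- v).
    by rewrite -[X in normc X <= _](addrK v) normcD.
  by rewrite normc1 normc_opp; lra.
have QvE : normc (Q * (1 + v)) = normc Q * normc (1 + v) by exact: normcM.
have diff : normc (1 - Q * (1 + v)) <= normc (1 - Q) + normc Q * normc v.
  have -> : 1 - Q * (1 + v) = (1 - Q) + (- (Q * v)) by ring.
  by rewrite (le_trans (normcD _ _)) // normc_opp normcM.
have lowQ : normc Q * (1 - t) <= normc (Q * (1 + v)).
  by rewrite QvE ler_wpM2l ?normc_ge0.
have nQ := normc_ge0 Q; have nv := normc_ge0 v; have nd := normc_ge0 (1 - Q).
have nv2 : normc Q * normc v <= normc Q * t by rewrite ler_wpM2l.
move: (normc (Q * (1 + v))) QvE lowQ => P _ lowQ.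
move: (normc (1 - Q * (1 + v))) diff => D diff.
move: (normc Q) (normc v) (normc (1 - Q)) nQ nv nd nv2 Q0 Q1 diff lowQ => p y z.
move=> p0 y0 z0 yt Q0 Q1 diff lowQ.
split; first by nra.
(* P >= p (1 - t), and D <= z + p t with z (1 - s) <= s p. *)
have h1 : D * (1 - (s + t)) <= (z + p * t) * (1 - (s + t)).
  by rewrite ler_wpM2r //; lra.
have h2 : (s + t) * (p * (1 - t)) <= (s + t) * P by rewrite ler_wpM2l //; lra.
apply: le_trans h1 _; apply: le_trans h2.
have h3 : z * (1 - (s + t)) <= s * p - t * z by nra.
suff : s * p - t * z + p * t * (1 - (s + t)) <= (s + t) * (p * (1 - t)) by nra.
have : 0 <= t * z by exact: mulr_ge0.
nra.
Qed.

(** Dividing by the real recursion reduces the claim to a product of factors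
    [1 + u_i] with [u_i = (z_i - r_i) / (1 + r_i)], with [a i] a bound on
    [|u_i|]; all higher-order effects are then in the factor [1 - s]. *)
Lemma ratio_perturbation (R : rcfType) (n : nat) (lam0 : R) (lam : R[i])
    (del : R) (r : 'I_n -> R) (z : 'I_n -> R[i]) (a : 'I_n -> R)
    (x := lam0 / \prod_i (1 + r i)) (s := \sum_i a i) :
  0 <= lam0 -> normc (lam - lam0%:C) <= del -> (forall i, 0 <= r i) ->
  (forall i, normc (z i - (r i)%:C) <= a i * (1 + r i)) -> s < 1 ->
  \prod_i (1 + z i) != 0 /\
  normc (lam / \prod_i (1 + z i) - x%:C) * (1 - s) <= x * s + del.
Proof.
move=> l0 ldel r0 za s1.
have rp i : 1 <= 1 + r i by have := r0 i; lra.
have rn i : 1 + r i != 0 by rewrite gt_eqF // (lt_le_trans _ (rp i)).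
have rnC i : 1 + (r i)%:C != 0 :> R[i].
  by rewrite -(rmorph1 (real_complex R)) -rmorphD fmorph_eq0.
pose u i := (z i - (r i)%:C) / (1 + (r i)%:C).
have ua i : normc (u i) <= a i.
  rewrite normcM normcV -(rmorph1 (real_complex R)) -rmorphD.
  rewrite normc_real; last exact: le_trans (rp i).
  by rewrite ler_pdivrMr // (lt_le_trans _ (rp i)).
have [Q0 Q1] := prod_near1 ua s1; rewrite -/s in Q0 Q1.
set Q := \prod_i _ in Q0 Q1.
have PQ : \prod_i (1 + z i) = (\prod_i (1 + r i))%:C * Q.
  rewrite rmorph_prod -big_split /=; apply: eq_bigr => i _.
  by rewrite /u rmorphD rmorph1; field; exact: rnC.
set P := \prod_i (1 + r i) in x PQ *.
have P1 : 1 <= P.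
  rewrite /P; elim/big_ind: _ => // y1 y2 *; exact: mulr_ege1.
have Pp : 0 < P by exact: lt_le_trans P1.
have nQ : 0 < normc Q by apply: lt_le_trans Q0; lra.
have Qn : Q != 0 by apply: contraTneq nQ => ->; rewrite normc0 ltxx.
have PnC : P%:C != 0 :> R[i] by rewrite fmorph_eq0 gt_eqF.
rewrite PQ mulf_neq0 //; split=> //.
have -> : lam / (P%:C * Q) - x%:C
    = (x%:C * (1 - Q) + (lam - lam0%:C) / P%:C) / Q.
  rewrite /x rmorphM fmorphV; field; exact/andP.
rewrite normcM normcV mulrAC ler_pdivrMr //.
have x0 : 0 <= x by rewrite divr_ge0 // ltW.
have d0 : 0 <= del by exact: le_trans (normc_ge0 _) ldel.
have num : normc (x%:C * (1 - Q) + (lam - lam0%:C) / P%:C)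
    <= x * normc (1 - Q) + del.
  apply: le_trans (normcD _ _) _; rewrite normcM normc_real // lerD2l.
  rewrite normcM normcV normc_real ?(ltW Pp) // ler_pdivrMr //.
  by apply: le_trans ldel _; rewrite ler_peMr.
apply: (@le_trans _ _ ((x * normc (1 - Q) + del) * (1 - s))).
  by rewrite ler_wpM2r //; lra.
have h : x * (normc (1 - Q) * (1 - s)) <= x * (s * normc Q) by rewrite ler_wpM2l.
have h2 : del * (1 - s) <= del * normc Q by rewrite ler_wpM2l.
by lra.
Qed.

(** * The invariant region *)

(** [D] is the union of the discs of centre [r] in [[0, L]] and radius
    [eta psi(r)]. *)
Lemma invariant_region (R : rcfType) (d : nat) (eps : R) :
  (1 < d)%N -> 0 < eps < 1 ->
  exists2 delta : R, 0 < delta &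
  exists D : R[i] -> Prop, D 0 /\
  forall (lam0 : R) (lam : R[i]) (f : nat -> R[i]),
    0 <= lam0 <= (1 - eps) * lambda_crit R d.+1 ->
    normc (lam - lam0%:C) <= delta -> (forall i, D (f i)) ->
    D (lam / \prod_(i < d) (1 + f i)) /\
    (let P := \prod_(i < d.+1) (1 + f i) in P != 0 /\ 1 + lam / P != 0).
Proof.
move=> d1 eps01; have [c [/andP[c0 c2] contract]] := potential_contracts d1 eps01.
have /andP[e0 e1] := eps01.
have dp : 0 < d%:R :> R by rewrite ltr0n; apply: ltn_trans d1.
have d2 : 1 <= d%:R :> R by rewrite ler1n ltnW.
have lc0 : 0 < lambda_crit R d.+1 by exact: lambda_crit_gt0.
pose L := (1 - eps) * lambda_crit R d.+1.
have L0 : 0 <= L by apply: mulr_ge0; [lra | exact: ltW].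
have LE : (1 - eps) * lambda_crit R d.+1 = L by [].
clearbody L; rewrite LE.
pose k := c / d%:R.
have k0 : 0 < k by exact: divr_gt0.
have kc : k <= c by rewrite ler_pdivrMr // ler_peMr // ltW.
have kE : c / d%:R = k by [].
clearbody k; rewrite LE kE in contract.
pose psi (r : R) := Num.sqrt (r * (1 + r)) + k.
have psik r : k <= psi r by rewrite lerDr sqrtr_ge0.
have psi2 r : 0 <= r -> psi r / (1 + r) <= 2.
  move=> r0; rewrite ler_pdivrMr; last lra.
  have : Num.sqrt (r * (1 + r)) <= 1 + r.
    rewrite -[leRHS]ger0_norm; last lra.
    by rewrite -sqrtr_sqr ler_wsqrtr //; nra.
  by rewrite /psi; lra.
(* By psi2, an argument has relative error at most 2 eta; this choice makes
   the sum of d + 1 of them at most c / 4. *)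
pose eta : R := c / (8 * d.+1%:R).
have N0 : 0 < d.+1%:R :> R by rewrite ltr0n.
have eta0 : 0 < eta by apply: divr_gt0 => //; lra.
have etad : eta * d.+1%:R = c / 8
  by rewrite /eta; move: (d.+1%:R : R) N0 => N N0; field; exact: lt0r_neq0.
clearbody eta.
have eta1 : eta <= 1.
  have : eta <= eta * d.+1%:R by rewrite ler_peMr ?ler1n // ltW.
  by lra.
pose delta := c / 2 * eta * k.
have del0 : 0 < delta.
  by apply: mulr_gt0 => //; apply: mulr_gt0 => //; apply: divr_gt0.
have del1 : delta <= 1 / 4.
  have : eta * k <= 1 by rewrite mulr_ile1 ?(ltW eta0) ?(ltW k0) //; lra.
  have : 0 < eta * k by exact: mulr_gt0.
  by rewrite /delta; nra.
exists delta => //.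
exists (fun z => exists2 r, 0 <= r <= L & normc (z - r%:C) <= eta * psi r); split.
  exists 0; first by rewrite lexx.
  by rewrite subrr normc0 mulr_ge0 ?(ltW eta0) // (le_trans (ltW k0)).
move=> lam0 lam f /andP[l0 l1] ldel fD.
have [r rP] : exists r : nat -> R, forall i,
    0 <= r i <= L /\ normc (f i - (r i)%:C) <= eta * psi (r i).
  suff /boolp.choice[r rP] : forall i, exists r,
      0 <= r <= L /\ normc (f i - r%:C) <= eta * psi r by exists r.
  by move=> i; have [x x1 x2] := fD i; exists x.
have r0 i : 0 <= r i by case: (rP i) => /andP[].
have rp i : 0 < 1 + r i by have := r0 i; lra.
pose a i := eta * (psi (r i) / (1 + r i)).
have fa i : normc (f i - (r i)%:C) <= a i * (1 + r i).
  have -> : a i * (1 + r i) = eta * psi (r i).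
    by rewrite /a -mulrA divfK // gt_eqF.
  exact: (rP i).2.
have a2 i : a i <= 2 * eta.
  by rewrite /a mulrC ler_wpM2r ?psi2 // ltW.
have suma n : (n <= d.+1)%N -> \sum_(i < n) a i <= c / 4.
  move=> nd; apply: (@le_trans _ _ (n%:R * (2 * eta))).
    rewrite -[X in _ <= X%:R * _]card_ord mulr_natl -sumr_const.
    by apply: ler_sum.
  have : n%:R * eta <= d.+1%:R * eta by rewrite ler_wpM2r ?ler_nat // ltW.
  by lra.
have xL n : 0 <= lam0 / \prod_(i < n) (1 + r i) <= L.
  have P1 : 1 <= \prod_(i < n) (1 + r i).
    elim/big_ind: _ => // [y1 y2 h1 h2|i _]; first exact: mulr_ege1.
    by have := r0 i; lra.
  have Pp : 0 < \prod_(i < n) (1 + r i) by exact: lt_le_trans P1.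
  rewrite divr_ge0 ?(ltW Pp) //= ler_pdivrMr //.
  by apply: le_trans l1 _; rewrite ler_peMr.
have pert n : (n <= d.+1)%N ->
    let P := \prod_(i < n) (1 + f i) in let x := lam0 / \prod_(i < n) (1 + r i) in
    P != 0 /\ normc (lam / P - x%:C) * (1 - \sum_(i < n) a i)
              <= x * (\sum_(i < n) a i) + delta.
  move=> nd; apply: ratio_perturbation => //.
  by apply: le_lt_trans (suma n nd) _; lra.
split.
  have s1 := suma d (leqnSn d); have [_ H] := pert d (leqnSn d).
  set x := lam0 / _ in H; set s := \sum_i _ in H s1.
  have lamL : 0 <= lam0 <= L by rewrite l0 l1.
  have contr : x * \sum_(i < d) (psi (r i) / (1 + r i)) <= (1 - c) * psi x.
    exact: contract lam0 (fun i => r i) lamL (fun i => r0 i).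
  have sE : s = eta * \sum_(i < d) (psi (r i) / (1 + r i)) by rewrite mulr_sumr.
  exists x; first exact: xL.
  have xs : x * s <= eta * ((1 - c) * psi x) by rewrite sE mulrCA ler_wpM2l // ltW.
  (* The factor 1 - s uses up at most a quarter of the contraction c, and
     the error delta half of it. *)
  rewrite -(@ler_pM2r _ (1 - s)); last by lra.
  apply: le_trans H _; apply: le_trans (lerD xs (lexx _)) _.
  have h1 : delta <= c / 2 * (eta * psi x).
    by rewrite /delta -mulrA !ler_wpM2l //; lra.
  have h2 : s * (eta * psi x) <= c / 4 * (eta * psi x).
    by rewrite ler_wpM2r // mulr_ge0 ?(ltW eta0) // (le_trans (ltW k0)).
  have h3 : 0 <= c * (eta * psi x).
    by rewrite !mulr_ge0 ?(ltW eta0) ?(ltW c0) // (le_trans (ltW k0)).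
  by lra.
have s1 := suma d.+1 (leqnn _); have [P0 H] := pert d.+1 (leqnn _).
split=> //; set P := \prod_(i < _) _ in P0 H *.
set x := lam0 / _ in H; set s := \sum_i _ in H s1.
have /andP[x0 _] : 0 <= x <= L by exact: xL.
have s0 : 0 <= s.
  by apply: sumr_ge0 => i _; rewrite mulr_ge0 ?divr_ge0 ?(ltW eta0) ?(ltW (rp i)) //
    (le_trans (ltW k0)).
(* The value is close to the real number x >= 0, so it cannot be -1. *)
apply/eqP => z0.
have zE : lam / P - x%:C = - (1 + x)%:C.
  by rewrite rmorphD rmorph1 -[lam / P](addKr 1) z0; ring.
move: H; rewrite zE normc_opp normc_real; last lra.
have : x * s <= x * (c / 4) by rewrite ler_wpM2l.
have : x * c <= x * 2^-1 by rewrite ler_wpM2l.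
by nra.
Qed.

(** * Independence polynomials of induced subgraphs *)

Definition nbrs (G : sgraph) (v : G) : {set G} := [set w | edge v w]%SET.

Definition indep_poly_on (R : rcfType) (G : sgraph) (lambda : G -> R[i])
    (S : {set G}) : R[i] :=
  \sum_(I : {set G} | independent I && (I \subset S)%SET) \prod_(v in I) lambda v.

Lemma independentP (G : sgraph) (I : {set G}) :
  reflect {in I &, forall u v, ~~ edge u v} (independent I).
Proof.
apply: (iffP forall_inP) => [H u v uI vI|H u uI].
  by move/forall_inP: (H u uI); apply.
by apply/forall_inP => v vI; exact: H.
Qed.

Lemma indep_poly_onT (R : rcfType) (G : sgraph) (lambda : G -> R[i]) :
  indep_poly_on lambda finset.setT = indep_poly lambda.
Proof. by apply: eq_bigl => I; rewrite finset.subsetT andbT. Qed.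

Lemma indep_poly_on0 (R : rcfType) (G : sgraph) (lambda : G -> R[i]) :
  indep_poly_on lambda finset.set0 = 1.
Proof.
rewrite /indep_poly_on (big_pred1 finset.set0) ?big_set0 // => I.
rewrite finset.subset0 andb_idl // => /eqP->.
by apply/independentP => u v; rewrite inE.
Qed.

(** An independent set containing [v] is [v] together with an independent set
    that avoids the neighbours of [v]. *)
Lemma indep_poly_onU1 (R : rcfType) (G : sgraph) (lambda : G -> R[i])
    (S : {set G}) (v : G) : v \notin S ->
  indep_poly_on lambda (v |: S)%SET
  = indep_poly_on lambda S + lambda v * indep_poly_on lambda (S :\: nbrs v)%SET.
Proof.
move=> vS; rewrite /indep_poly_on (bigID (fun I : {set G} => v \in I)) /= addrC.
congr (_ + _).
  apply: eq_bigl => I; rewrite -andbA; congr (_ && _).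
  apply/andP/idP => [[IvS vI]|IS].
    apply/fintype.subsetP => w wI; have := fintype.subsetP IvS w wI.
    by rewrite !inE => /orP[/eqP wv|//]; rewrite wv (negbTE vI) in wI.
  split; first exact: fintype.subset_trans IS (finset.subsetUr _ _).
  by apply: contra vS; exact: fintype.subsetP.
rewrite (reindex_onto (fun J => v |: J)%SET (fun I => I :\ v)%SET) /=; last first.
  by move=> I /andP[_ vI]; exact: finset.setD1K.
rewrite mulr_sumr; apply: eq_big => [J|J].
  rewrite finset.setU11 andbT -andbA; apply/idP/idP.
    move=> /and3P[/independentP indJ JS /eqP Jv].
    have vJ : v \notin J by rewrite -Jv !inE eqxx.
    apply/andP; split.
      by apply/independentP => u w uJ wJ; apply: indJ; rewrite !inE ?uJ ?wJ orbT.
    apply/fintype.subsetP => w wJ; rewrite !inE indJ ?inE ?eqxx ?wJ ?orbT //=.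
    have := fintype.subsetP JS w; rewrite !inE wJ orbT => /(_ isT).
    by case: eqP => // wv; rewrite -wv wJ in vJ.
  move=> /andP[/independentP indJ /fintype.subsetP JS].
  have vJ : v \notin J.
    by apply: contra vS => /JS; rewrite !inE => /andP[].
  have Jv w : w \in J -> ~~ edge v w by move/JS; rewrite !inE => /andP[].
  apply/and3P; split.
  - apply/independentP => u w; rewrite !inE => /orP[/eqP->|uJ] /orP[/eqP->|wJ].
    + by rewrite edge_irrefl.
    + exact: Jv.
    + by rewrite edge_sym Jv.
    + exact: indJ.
  - by apply: finset.setUS; apply/fintype.subsetP => w /JS; rewrite !inE => /andP[].
  - by rewrite finset.setU1K.
move=> /andP[_ /eqP Jv]; have vJ : v \notin J by rewrite -Jv !inE eqxx.
by rewrite big_setU1.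
Qed.

(** The invariant of the induction over vertex sets.  The bound on the
    ratio is restricted to vertices with at most [d] neighbours in [S], those to
    which the recursion with [d] arguments applies; nonvanishing is a separate clause because
    a larger set need not contain any such vertex. *)
Definition ratio_claim (R : rcfType) (G : sgraph) (lambda : G -> R[i])
    (d : nat) (D : R[i] -> Prop) (S : {set G}) : Prop :=
  indep_poly_on lambda S != 0 /\
  forall v, v \notin S -> (#|nbrs v :&: S|%SET <= d)%N ->
  exists2 z, D z &
    indep_poly_on lambda (v |: S)%SET = (1 + z) * indep_poly_on lambda S.

(** Putting the vertices of [W] back one at a time multiplies the sum by one
    factor [1 + z] each.  The vertex [v] lies outside [S] and is a neighbour of
    every vertex of [W], so these have at most [d] neighbours in [S] and the
    claim applies to them.  Missing factors are filled up with [z = 0], so the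
    number [n] of factors need not depend on [W]. *)
Lemma ratio_telescope (R : rcfType) (G : sgraph) (lambda : G -> R[i])
    (d : nat) (D : R[i] -> Prop) (S : {set G}) (v : G) :
  (max_degree G <= d.+1)%N -> D 0 -> v \notin S ->
  (forall T : {set G}, (T \proper S)%SET -> ratio_claim lambda d D T) ->
  forall n (W : {set G}), (W \subset nbrs v :&: S)%SET -> (#|W| <= n)%N ->
  exists2 f : nat -> R[i], forall i, D (f i) &
    indep_poly_on lambda S
    = indep_poly_on lambda (S :\: W)%SET * \prod_(i < n) (1 + f i).
Proof.
move=> maxd D0 vS claim; elim=> [|n IHn] W WN Wn.
  exists (fun=> 0) => //; move: Wn; rewrite leqn0 finset.cards_eq0 => /eqP->.
  by rewrite finset.setD0 big_ord0 mulr1.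
have [W0|[u uW]] := finset.set_0Vmem W.
  exists (fun=> 0) => //; rewrite W0 finset.setD0 big1 ?mulr1 // => i _.
  by rewrite addr0.
have [] := IHn (W :\ u)%SET.
- exact: fintype.subset_trans (finset.subsetDl _ _) WN.
- by move: Wn; rewrite (finset.cardsD1 u) uW.
move=> f fD fE.
have := fintype.subsetP WN u uW; rewrite !inE => /andP[vu uS].
have SW : (S :\: (W :\ u))%SET = (u |: (S :\: W))%SET.
  by apply/setP => w; rewrite !inE; case: eqP => // ->; rewrite uS.
have SWp : (S :\: W \proper S)%SET.
  apply/fintype.properP; split; first exact: finset.subsetDl.
  by exists u; rewrite // !inE uW.
have [_ /(_ u)] := claim _ SWp; rewrite inE uW /= => /(_ isT) [].
  rewrite -ltnS; apply: leq_trans maxd.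
  apply: (@leq_trans (degree u)); last exact: leq_bigmax.
  apply: fintype.proper_card; apply/fintype.properP; split.
    by apply/fintype.subsetP => w; rewrite !inE => /andP[].
  by exists v; rewrite !inE ?(negbTE vS) ?andbF // edge_sym.
move=> z zD zE.
exists (fun i => if i == n then z else f i) => [i|]; first by case: eqP.
rewrite fE SW zE big_ord_recr /= eqxx.
under [in RHS]eq_bigr => i _ do rewrite (ltn_eqF (ltn_ord i)).
by rewrite -mulrA mulrC mulrA.
Qed.

(** The two hypotheses on [D] play different roles.  A vertex with at most [d]
    neighbours gives a ratio in [D], as the induction needs; nonvanishing on
    [S] itself needs one vertex that may have [d + 1] neighbours, whose ratio
    only has to differ from [-1]. *)
Lemma indep_poly_neq0_of_region (R : rcfType) (G : sgraph)
    (lambda : G -> R[i]) (d : nat) (D : R[i] -> Prop) :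
  (max_degree G <= d.+1)%N -> D 0 ->
  (forall f : nat -> R[i], (forall i, D (f i)) -> forall v,
     D (lambda v / \prod_(i < d) (1 + f i))) ->
  (forall f : nat -> R[i], (forall i, D (f i)) -> forall v,
     let P := \prod_(i < d.+1) (1 + f i) in P != 0 /\ 1 + lambda v / P != 0) ->
  indep_poly lambda != 0.
Proof.
move=> maxd D0 Dd DS; rewrite -indep_poly_onT.
suff claim S : ratio_claim lambda d D S by case: (claim finset.setT).
have [k] := ubnP #|S|; elim: k S => // k IHk S Sk.
have small (T : {set G}) : (#|T| < #|S|)%N -> ratio_claim lambda d D T.
  by move=> TS; apply: IHk; apply: leq_trans TS _.
have nz : indep_poly_on lambda S != 0.
  have [->|[u uS]] := finset.set_0Vmem S; first by rewrite indep_poly_on0 oner_eq0.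
  have cS : (#|S :\ u|%SET < #|S|)%N by rewrite [in X in (_ < X)%N](finset.cardsD1 u) uS.
  have uSu : u \notin (S :\ u)%SET by rewrite !inE eqxx.
  have uN : (#|nbrs u :&: (S :\ u)|%SET <= d.+1)%N.
    apply: leq_trans (leq_trans (leq_bigmax u) maxd).
    exact/fintype.subset_leq_card/finset.subsetIl.
  have [|f fD fE] := @ratio_telescope R G lambda d D (S :\ u)%SET u maxd D0 uSu
    _ d.+1 _ (fintype.subxx _) uN.
    by move=> T /fintype.proper_card Tu; apply: small; exact: ltn_trans Tu cS.
  have [P0 P1] := DS f fD u.
  have [nzu _] := small _ cS.
  rewrite -(finset.setD1K uS) indep_poly_onU1 //.
  have DE : (S :\ u :\: (nbrs u :&: (S :\ u)))%SET = (S :\ u :\: nbrs u)%SET.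
    by apply/setP => w; rewrite !inE; case: (w == u); case: (edge u w); case: (w \in S).
  rewrite DE in fE.
  have -> : indep_poly_on lambda (S :\ u :\: nbrs u)%SET
      = indep_poly_on lambda (S :\ u)%SET / \prod_(i < d.+1) (1 + f i).
    by rewrite fE mulfK.
  by rewrite mulrCA -[X in X + _]mulr1 -mulrDr mulf_neq0.
split=> // v vS vd.
have [|f fD fE] := @ratio_telescope R G lambda d D S v maxd D0 vS
    _ d (nbrs v :&: S)%SET (fintype.subxx _) vd.
  by move=> T /fintype.proper_card; exact: small.
have DE : (S :\: (nbrs v :&: S))%SET = (S :\: nbrs v)%SET.
  by apply/setP => w; rewrite !inE; case: (w \in S); rewrite ?andbF ?andbT.
rewrite DE in fE.
have P0 : \prod_(i < d) (1 + f i) != 0.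
  by apply: contraNneq nz => P0; rewrite fE P0 mulr0.
exists (lambda v / \prod_(i < d) (1 + f i)); first exact: Dd.
rewrite indep_poly_onU1 // mulrDl mul1r; congr (_ + _).
by rewrite fE mulrA mulrAC divfK // mulrC.
Qed.

(** * The zero-free neighbourhood *)

Theorem theorem4p2 (R : realType) (Delta : nat) (hDelta : (3 <= Delta)%N) :
  forall eps : R, 0 < eps ->
  exists2 delta : R, 0 < delta &
    forall (G : sgraph) (lambda : G -> R[i]),
      (max_degree G <= Delta)%N ->
      (forall v : G,
         nbhd (real_segment ((1 - eps) * lambda_crit R Delta)) delta
           (lambda v)) ->
      indep_poly lambda != 0.
Proof.
move=> eps e0; case: Delta hDelta => // d; rewrite ltnS => d1.
have lc0 : 0 < lambda_crit R d.+1 by exact: lambda_crit_gt0.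
have [e1|e1] := leP 1 eps.
  (* The segment is empty, so the graph has no vertex. *)
  exists 1 => // G lambda _ near.
  rewrite -indep_poly_onT (_ : finset.setT = finset.set0) ?indep_poly_on0 ?oner_eq0 //.
  apply/setP => v; have [a [x]] := near v.
  rewrite /= in_itv /= => /andP[x0 xl] _ _.
  have : (1 - eps) * lambda_crit R d.+1 <= 0 by apply: mulr_le0_ge0; [lra | exact: ltW].
  by lra.
have [|delta del0 [D [D0 inv]]] := @invariant_region R d eps d1; first exact/andP.
exists delta => // G lambda maxd near.
have centre v : exists2 lam0 : R, 0 <= lam0 <= (1 - eps) * lambda_crit R d.+1 &
    normc (lambda v - lam0%:C) <= delta.
  have [a [x]] := near v; rewrite /= in_itv /= => /andP[x0 xl] <- dist.
  exists x; first by rewrite x0 ltW.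
  by apply: ltW; rewrite -ltcR -normr_normc.
apply: (indep_poly_neq0_of_region maxd D0) => f fD v.
  by have [lam0 lam0L lam0d] := centre v; case: (inv _ _ f lam0L lam0d fD).
by have [lam0 lam0L lam0d] := centre v; case: (inv _ _ f lam0L lam0d fD).
Qed.
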